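(* Let $B(1,2)=\langle a,b\mid bab^{-1}=a^2\rangle$. Besides the four standard bi-orderings of $B(1,2)$ (described in the context), the space of left-orderings of $B(1,2)$ is made up of the left-orderings $\preceq_\varepsilon$ for $\varepsilon\in\mathbb{R}\setminus\mathbb{Q}$, the left-orderings $\preceq_\varepsilon^+$ and $\preceq_\varepsilon^-$ for $\varepsilon\in\mathbb{Q}$, and the opposites of all of these. In particular, every non-Conradian left-ordering on $B(1,2)$ can be realized as an induced ordering coming from an affine action of $B(1,2)$ on the real line.
   Context: A left-ordering on a group $G$ is a left-invariant total order $\preceq$; $g$ is positive if $g\succ id$; a bi-ordering is a total order that is both left- and right-invariant. A left-ordering is determined by its set of positive elements. The opposite $\overline{\preceq}$ of a left-ordering $\preceq$ is the left-ordering whose positive elements are the inverses of the $\preceq$-positive elements. A left-ordering $\preceq$ is Conradian if for all positive $f,g$ there is $n\in\mathbb{N}=\{1,2,\ldots\}$ with $fg^n\succ g$. The four standard bi-orderings: let $\langle\langle a\rangle\rangle=a^{\mathbb{Z}[\frac12]}$ be the largest rank-1 Abelian subgroup of $B(1,2)$ containing $a$; it consists of the elements $a^{m/2^k}:=b^{-k}a^mb^k$ with $m\in\mathbb{Z}$, $k\in\mathbb{N}$, is normal, is isomorphic to the group $\mathbb{Z}[\frac12]$ of dyadic rationals via $a^r\mapsto r$, and $B(1,2)/\langle\langle a\rangle\rangle\cong\mathbb{Z}$ is generated by the image of $b$. The four bi-orderings are obtained from the series $\{id\}\lhd\langle\langle a\rangle\rangle\lhd B(1,2)$ by choosing one of the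 two orderings on $\langle\langle a\rangle\rangle\cong\mathbb{Z}[\frac12]\subset\mathbb{R}$ and one of the two orderings on the quotient $\mathbb{Z}$: an element outside $\langle\langle a\rangle\rangle$ is positive iff its image in $\mathbb{Z}$ is positive for the chosen ordering, and an element of $\langle\langle a\rangle\rangle$ is positive iff it is positive for the ordering chosen there. The orderings $\preceq_\varepsilon$, $\preceq_\varepsilon^\pm$: let $\xi:B(1,2)\to\mathrm{Homeo}_+(\mathbb{R})$ be the embedding given by $\xi(a):x\mapsto x+1$, $\xi(b):x\mapsto 2x$. For irrational $\varepsilon$, $\preceq_\varepsilon$ is the left-ordering with set of positive elements $\{g\in B(1,2)\mid\xi(g)(\varepsilon)>\varepsilon\}$. For rational $\varepsilon$, the stabilizer of $\varepsilon$ is isomorphic to $\mathbb{Z}$, so this set defines only a partial left-ordering, which can be completed to exactly two total left-orderings $\preceq_\varepsilon^+$ and $\preceq_\varepsilon^-$; here $\preceq_\varepsilon^+$ (resp. $\preceq_\varepsilon^-$) is the limit of $\preceq_{\varepsilon_n}$ for any sequence of irrational numbers $\varepsilon_n$ converging to $\varepsilon$ from the right (resp. left). The limit is taken in the topology on left-orderings in which convergence means that, for each fixed group element, its sign is eventually constant and equal to its sign in the limit. Induced ordering: if a group $G$ acts faithfully by order-preserving bijections on a totally ordered set $(\Omega,\leq)$ and $\leq^*$ is a well-order on $\Omega$, then for $f\neq id$ put $w_f=\min_{\leq^*}\{w\in\Omega\mid f(w)\neq w\}$; the ordering on $G$ induced from the action (and $\leq^*$) is the left-ordering defined by $f\succ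 id$ iff $f(w_f)>w_f$. An affine action on $\mathbb{R}$ is an action by orientation-preserving affine homeomorphisms $x\mapsto sx+t$, $s>0$. *)

(* Defs.v *)
From HB Require Import structures.
From mathcomp Require Import all_boot all_order all_algebra.
From mathcomp Require Import boolp classical_sets wochoice reals.
From mathcomp Require Import topology normedtype sequences.
Import Order.TTheory GRing.Theory Num.Theory.
Import numFieldNormedType.Exports.

Set Implicit Arguments.
Unset Strict Implicit.
Unset Printing Implicit Defensive.

Local Open Scope group_scope.
Local Open Scope classical_set_scope.

(* The letter (false, e) stands for a and (true, e) for b; e = true marks the
   inverse letter. *)
Definition letter : Type := (bool * bool)%type.
Definition linv (l : letter) : letter := (l.1, ~~ l.2).
Definition la : letter := (false, false).
Definition lb : letter := (true, false).

(* The least congruence on words that makes inverse letters cancel and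
   satisfies the relation b a b^-1 = a^2. *)
Inductive bs_equiv : seq letter -> seq letter -> Prop :=
| bs_refl s : bs_equiv s s
| bs_sym s t : bs_equiv s t -> bs_equiv t s
| bs_trans s t u : bs_equiv s t -> bs_equiv t u -> bs_equiv s u
| bs_cat s s' t t' :
    bs_equiv s s' -> bs_equiv t t' -> bs_equiv (s ++ t) (s' ++ t')
| bs_cancel l : bs_equiv [:: l; linv l] [::]
| bs_rel : bs_equiv [:: lb; la; linv lb] [:: la; la].

Definition bs_equivb (s t : seq letter) : bool := `[< bs_equiv s t >].

Lemma bs_equivb_refl : reflexive bs_equivb.
Proof. by move=> s; apply/asboolP; exact: bs_refl. Qed.

Lemma bs_equivb_sym : symmetric bs_equivb.
Proof. by move=> s t; apply/asboolP/asboolP; exact: bs_sym. Qed.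

Lemma bs_equivb_trans : transitive bs_equivb.
Proof.
by move=> t s u /asboolP st /asboolP tu; apply/asboolP; exact: bs_trans st tu.
Qed.

Canonical bs_equiv_rel :=
  EquivRel bs_equivb bs_equivb_refl bs_equivb_sym bs_equivb_trans.

(* B(1,2) = < a, b | b a b^-1 = a^2 > *)
Definition B12 : Type := {eq_quot bs_equivb}%qT.
HB.instance Definition _ := Choice.on B12.
HB.instance Definition _ := EqQuotient.on B12.

Lemma B12_eqP (s t : seq letter) :
  (\pi_B12 s = \pi_B12 t)%qT <-> bs_equiv s t.
Proof.
split=> [/eqquotP/asboolP //|st].
by apply/eqquotP; apply/asboolP.
Qed.

Lemma B12_repr (s : seq letter) : bs_equiv (repr (\pi_B12 s)%qT) s.
Proof. by apply/B12_eqP; rewrite reprK. Qed.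

Definition winv (s : seq letter) : seq letter := rev (map linv s).

Definition B12_one : B12 := (\pi_B12 [::])%qT.
Definition B12_mul (g h : B12) : B12 := (\pi_B12 (repr g ++ repr h))%qT.
Definition B12_inv (g : B12) : B12 := (\pi_B12 (winv (repr g)))%qT.

Lemma linvK : involutive linv.
Proof. by case=> x e; rewrite /linv /= negbK. Qed.

Lemma winvK : involutive winv.
Proof. by move=> s; rewrite /winv map_rev revK mapK //; exact: linvK. Qed.

Lemma bs_winv s : bs_equiv (s ++ winv s) [::].
Proof.
elim: s => [|l s IH]; first exact: bs_refl.
rewrite /winv /= rev_cons -cats1 -/(winv s).
rewrite -[_ :: _]/([:: l] ++ (s ++ (winv s ++ [:: linv l]))) [s ++ _]catA.
apply: (bs_trans _ (bs_cancel l)).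
apply: (bs_cat (bs_refl [:: l])).
exact: (bs_cat IH (bs_refl [:: linv l])).
Qed.

Lemma B12_mulE s t : B12_mul (\pi_B12 s)%qT (\pi_B12 t)%qT = (\pi_B12 (s ++ t))%qT.
Proof. by apply/B12_eqP; apply: bs_cat; exact: B12_repr. Qed.

Lemma B12_mulA : associative B12_mul.
Proof.
move=> x y z; apply/B12_eqP.
apply: (bs_trans (bs_cat (bs_refl _) (B12_repr _))).
apply: bs_sym; apply: (bs_trans (bs_cat (B12_repr _) (bs_refl _))).
by rewrite catA; exact: bs_refl.
Qed.

Lemma B12_mul1 : left_id B12_one B12_mul.
Proof.
move=> x; rewrite -[RHS]reprK; apply/B12_eqP.
exact: (bs_cat (B12_repr [::]) (bs_refl (repr x))).
Qed.

Lemma B12_mulr1 : right_id B12_one B12_mul.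
Proof.
move=> x; rewrite -[RHS]reprK; apply/B12_eqP.
by rewrite -[X in bs_equiv _ X]cats0; exact: (bs_cat (bs_refl _) (B12_repr [::])).
Qed.

Lemma B12_mulV : left_inverse B12_one B12_inv B12_mul.
Proof.
move=> x; apply/B12_eqP.
apply: (bs_trans (bs_cat (B12_repr _) (bs_refl _))).
by rewrite -{2}[repr x]winvK; exact: bs_winv.
Qed.

Lemma B12_mulrV : right_inverse B12_one B12_inv B12_mul.
Proof.
move=> x; apply/B12_eqP.
apply: (bs_trans (bs_cat (bs_refl _) (B12_repr _))).
exact: bs_winv.
Qed.

HB.instance Definition _ := isGroup.Build B12
  B12_mulA B12_mul1 B12_mulr1 B12_mulV B12_mulrV.

Definition gen_a : B12 := (\pi_B12 [:: la])%qT.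
Definition gen_b : B12 := (\pi_B12 [:: lb])%qT.

Lemma B12_relation : gen_b * gen_a * gen_b^-1 = gen_a ^+ 2.
Proof.
have bV : gen_b^-1 = (\pi_B12 [:: linv lb])%qT.
  apply: (mulgI gen_b); rewrite mulgV; apply: esym.
  by apply: etrans (B12_mulE _ _) _; apply/B12_eqP; exact: bs_cancel.
rewrite bV expg2.
apply: etrans (congr1 (B12_mul^~ _) (B12_mulE [:: lb] [:: la])) _.
apply: etrans (B12_mulE _ _) _; apply: esym; apply: etrans (B12_mulE _ _) _.
by apply/B12_eqP; apply: bs_sym; exact: bs_rel.
Qed.

Definition expgz (G : groupType) (x : G) (n : int) : G :=
  match n with Posz k => x ^+ k | Negz k => x ^- k.+1 end.

Section Orderings.
Variable G : groupType.
Implicit Types (le : rel G) (P : set G).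

Definition left_ordering le : Prop :=
  total_order le /\ forall h f g, le f g -> le (h * f) (h * g).

Definition strict le : rel G := fun f g => le f g && (f != g).

Definition positive le (g : G) : bool := strict le 1 g.

Definition conradian le : Prop := forall f g, positive le f -> positive le g ->
  exists2 n : nat, (0 < n)%N & strict le g (f * g ^+ n).

(* The left-invariant relation whose set of positive elements is P (away from
   the identity); it is an ordering only for suitable P. *)
Definition ordering_of_cone P : rel G :=
  fun f g => (f == g) || `[< P (f^-1 * g) >].

Definition opposite le : rel G :=
  ordering_of_cone [set g | positive le g^-1].

End Orderings.

Section InducedOrdering.
Variables (G : groupType) (d : Order.disp_t) (Omega : orderType d).
Implicit Types (act : G -> Omega -> Omega) (wle : rel Omega).

Definition order_action act : Prop :=
  [/\ forall w, act 1 w = w,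
      forall f g w, act (f * g) w = act f (act g w) &
      forall g w w', (w <= w')%O -> (act g w <= act g w')%O].

Definition faithful_action act : Prop :=
  forall f, (forall w, act f w = w) -> f = 1.

(* The element w below is w_f; there is none when f = 1. *)
Definition induced_ordering act wle : rel G :=
  ordering_of_cone [set f | exists2 w : Omega,
    minimum_of wle [pred w' | act f w' != w'] w & (w < act f w)%O].

End InducedOrdering.

Definition affine_action (G : groupType) (R : realType) (act : G -> R -> R) :
    Prop :=
  order_action act /\
  forall g, exists s t : R, (0 < s)%R /\ forall x, (act g x = s * x + t)%R.

Section AffineEmbedding.
Variable R : realType.
Local Open Scope ring_scope.

Definition letter_act (l : letter) (x : R) : R :=
  match l with
  | (false, false) => x + 1
  | (false, true) => x - 1
  | (true, false) => 2 * x
  | (true, true) => x / 2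
  end.

Definition word_act (s : seq letter) (x : R) : R := foldr letter_act x s.

Lemma word_act_equiv s t : bs_equiv s t -> word_act s =1 word_act t.
Proof.
elim=> {s t} [//|s t _ st x|s t u _ st _ tu x|s s' t t' _ ss' _ tt' x|l x|x].
- by rewrite st.
- by rewrite st tu.
- by rewrite /word_act !foldr_cat -!/(word_act _ _) tt' ss'.
- case: l => [[] []] /=.
  + by rewrite mulrAC divff ?mul1r ?pnatr_eq0.
  + by rewrite mulrCA divff ?mulr1 ?pnatr_eq0.
  + by rewrite addrK.
  + by rewrite subrK.
- by rewrite /= mulrDr mulr1 mulrCA divff ?mulr1 ?pnatr_eq0 // -addrA.
Qed.

Definition xi (g : B12) (x : R) : R := word_act (repr g) x.

Lemma xi1 x : xi 1%g x = x.
Proof. exact: (word_act_equiv (B12_repr [::])). Qed.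

Lemma xiM g h x : xi (g * h)%g x = xi g (xi h x).
Proof. by rewrite /xi (word_act_equiv (B12_repr _)) /word_act foldr_cat. Qed.

Lemma xi_a x : xi gen_a x = x + 1.
Proof. exact: (word_act_equiv (B12_repr [:: la])). Qed.

Lemma xi_b x : xi gen_b x = 2 * x.
Proof. exact: (word_act_equiv (B12_repr [:: lb])). Qed.

Definition prec (eps : R) : rel B12 :=
  ordering_of_cone [set g | eps < xi g eps].

(* The sign of g in the limit is its eventual sign along every sequence of
   irrationals tending to eps from the given side. *)
Definition prec_plus (eps : R) : rel B12 :=
  ordering_of_cone [set g | forall u : nat -> R,
    (forall n, irrational (u n) /\ eps < u n) -> u @ \oo --> eps ->
    \forall n \near \oo, positive (prec (u n)) g].

Definition prec_minus (eps : R) : rel B12 :=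
  ordering_of_cone [set g | forall u : nat -> R,
    (forall n, irrational (u n) /\ u n < eps) -> u @ \oo --> eps ->
    \forall n \near \oo, positive (prec (u n)) g].

Definition prec_family (le : rel B12) : Prop :=
  [\/ exists2 eps : R, irrational eps & le = prec eps,
      exists2 eps : R, rational eps & le = prec_plus eps |
      exists2 eps : R, rational eps & le = prec_minus eps].

End AffineEmbedding.

(* a_dyadic m k is a^(m / 2^k). *)
Definition a_dyadic (m : int) (k : nat) : B12 := gen_b ^- k * expgz gen_a m * gen_b ^+ k.

Definition oriented (K : numDomainType) (s : bool) (x : K) : bool :=
  if s then (0 < x)%R else (x < 0)%R.

(* sa orients <<a>> (identified with Z[1/2] by a^r |-> r) and sb orients the
   quotient B(1,2)/<<a>>, where b^n h with h in <<a>> maps to n. *)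
Definition standard_biordering (sa sb : bool) : rel B12 :=
  ordering_of_cone [set g |
    (exists m k, g = a_dyadic m k /\ oriented sa (m%:~R / 2 ^+ k : rat)%R) \/
    (exists n m k, g = expgz gen_b n * a_dyadic m k /\ oriented sb n)].

(* Main.v *)
Require Import Defs.
From mathcomp Require Import all_boot all_order all_algebra.
From mathcomp Require Import boolp classical_sets wochoice reals.
From mathcomp Require Import topology normedtype sequences.
From mathcomp Require Import trigo pi_irrational.
From mathcomp Require Import ring lra.
Import Order.TTheory GRing.Theory Num.Theory.
Import numFieldNormedType.Exports.

Set Implicit Arguments.
Unset Strict Implicit.
Unset Printing Implicit Defensive.

Local Open Scope group_scope.
Local Open Scope classical_set_scope.

(** Write A for <<a>>.  The action xi is faithful, and it turns an element g
    of B(1,2) into x |-> scale g * x + offset g, where scale g is a power of 2;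
    A is the set of elements of scale 1, and offset identifies A with Z[1/2]
    inside R.  Every identity in the group is therefore checked on the two
    numbers scale and offset.

    Let le be a left-ordering.  Since A has rank 1, the sign of a decides the
    sign of every element of A (positive_translation).  If b lies above all of
    A, or below all of it, then the relation b t = t^2 b makes the sign of an
    element outside A depend on its image in Z only, and le is one of the four
    standard bi-orderings (standard_of_b_above, standard_of_b_below).

    Otherwise b lies between two elements of A.  Passing to the opposite
    ordering if necessary, assume a positive.  Every g then cuts A at a real
    number, the supremum of the r with a^r below g.  Let eps be the cut of b.
    Left multiplication by a moves a cut x to x + 1, and left multiplication by
    b moves it to 2 x + eps; so after the change of variable y = x + eps the
    generators act on cuts exactly as xi does.  As the identity cuts A at 0,
    any g cuts it at xi g eps - eps (cut_xi).  Hence xi g eps > eps forces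
    g > 1.  This leaves the sign of the elements fixing eps; any two of
    them that expand have a common power (stabilizer_commensurable), so a
    single sign decides the whole stabilizer (germ_of_xi_positive).

    The orderings of the family are thus those of the cones germ_cone eps s:
    an element is positive when it moves eps to the right, or fixes eps and
    expands (for s true) or contracts (for s false).  When eps is irrational
    nothing but 1 fixes it, and this is prec eps; when eps is rational the two
    choices of s are the limits from the right and from the left, because an
    element fixing eps moves the points on one given side of eps all in the
    same direction (eventually_germ_cone).

    For the last assertion, conjugation by an element of the group preserves
    scale and multiplies offset by a positive number on A, so the standard
    bi-orderings are Conradian.  An ordering given by germ_cone eps s is
    induced from xi by any well-order starting with eps and then a point on the
    side of eps selected by s; its opposite is induced in the same way
    from the conjugate of xi by x |-> - x. *)

(** * Integer powers in a group *)

Section IntegerPowers.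
Variable G : groupType.
Implicit Types (x y : G) (m : int) (n : nat).

Lemma expgzS x m : expgz x (m + 1)%R = x * expgz x m.
Proof.
case: m => [n|[|n]] /=; first by rewrite addn1 expgS.
  by rewrite expg1 mulgV.
by rewrite [x ^+ n.+2]expgSr invgM mulgA mulgV mul1g subn1.
Qed.

Lemma expgzDn x n m : expgz x (m + n%:Z)%R = x ^+ n * expgz x m.
Proof.
elim: n => [|n IH]; first by rewrite addr0 mul1g.
by rewrite -addn1 PoszD addrA expgzS IH addn1 expgS mulgA.
Qed.

Lemma expgzBn x n m : expgz x (m - n%:Z)%R = x ^- n * expgz x m.
Proof. by rewrite -{2}[m](subrK n%:Z%R) expgzDn mulKg. Qed.

Lemma expgzJ x y m : expgz x m ^ y = expgz (x ^ y) m.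
Proof. by case: m => n /=; rewrite ?conjVg conjXg. Qed.

Lemma expgz_sqr x m : expgz (x ^+ 2) m = expgz x (m * 2%:Z)%R.
Proof.
case: m => n; first by rewrite /= -expgnA mulnC.
have -> : (Negz n * 2%:Z)%R = Negz (n.*2.+1).
  by rewrite !NegzE mulNr -PoszM muln2 doubleS.
by rewrite /= -expgnA; congr (_ ^- _); rewrite mul2n.
Qed.

End IntegerPowers.

(** * Normal forms in B(1,2) *)

Lemma B12_ind (P : B12 -> Prop) :
  P 1 ->
  (forall g, P g -> P (gen_a * g)) -> (forall g, P g -> P (gen_a^-1 * g)) ->
  (forall g, P g -> P (gen_b * g)) -> (forall g, P g -> P (gen_b^-1 * g)) ->
  forall g, P g.
Proof.
move=> P1 Pa PaV Pb PbV g; rewrite -[g]reprK.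
have piV l : (\pi_B12 [:: l])%qT^-1 = (\pi_B12 [:: linv l])%qT :> B12.
  apply: (mulgI (\pi_B12 [:: l])%qT); rewrite mulgV; apply: esym.
  by apply: etrans (B12_mulE _ _) _; apply/B12_eqP; exact: bs_cancel.
elim: (repr g) => [//|l s IH].
have -> : (\pi_B12 (l :: s))%qT = (\pi_B12 [:: l])%qT * (\pi_B12 s)%qT :> B12.
  exact: esym (B12_mulE [:: l] s).
case: l => [[] []].
- by have <- := piV lb; exact: PbV.
- exact: Pb.
- by have <- := piV la; exact: PaV.
- exact: Pa.
Qed.

Lemma gen_bJ m : gen_b * expgz gen_a m = expgz gen_a (m * 2%:Z)%R * gen_b.
Proof.
rewrite -expgz_sqr -B12_relation; apply: (mulIg gen_b^-1); rewrite mulgK.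
have e (z : B12) : gen_b * z * gen_b^-1 = z ^ gen_b^-1.
  by rewrite conjgE invgK mulgA.
by rewrite !e expgzJ.
Qed.

Lemma gen_bXJ k m :
  gen_b ^+ k * expgz gen_a m = expgz gen_a (m * (2 ^ k)%N%:Z)%R * gen_b ^+ k.
Proof.
elim: k m => [|k IH] m; first by rewrite mulr1 mul1g mulg1.
rewrite expgSr -mulgA gen_bJ mulgA IH -mulgA; congr (expgz _ _ * _).
by rewrite -mulrA -PoszM -expnS.
Qed.

Lemma gen_a_bVX k : gen_a * gen_b ^- k = gen_b ^- k * gen_a ^+ (2 ^ k)%N.
Proof.
apply: (mulgI (gen_b ^+ k)); rewrite mulVKg mulgA.
have /= := gen_bXJ k 1%:Z%R; rewrite expg1 => ->.
by rewrite mulgK mul1n.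
Qed.

(** The set of these products contains 1 and is stable under left
    multiplication by the generators and their inverses: a moves past b^-k at
    the price of becoming a^(2^k), and b moves past a^m when k = 0. *)
Lemma B12_normal_form_sandwich g :
  exists k m l, g = gen_b ^- k * expgz gen_a m * gen_b ^+ l.
Proof.
elim/B12_ind: g => [|g|g|g|g].
- by exists 0, 0%R, 0; rewrite /= !mulg1 invg1.
- move=> [k [m [l ->]]]; exists k, (m + (2 ^ k)%N%:Z)%R, l.
  by rewrite expgzDn !mulgA gen_a_bVX.
- move=> [k [m [l ->]]]; exists k, (m - (2 ^ k)%N%:Z)%R, l.
  rewrite expgzBn !mulgA; congr (_ * _ * _).
  by apply: (mulgI gen_a); rewrite mulVKg mulgA gen_a_bVX mulgK.
- move=> [[|k] [m [l ->]]].
    exists 0, (m * 2)%R, l.+1; rewrite invg1 !mul1g mulgA gen_bJ.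
    by rewrite expgS !mulgA.
  by exists k, m, l; rewrite expgSr invgM !mulgA mulgV mul1g.
- move=> [k [m [l ->]]]; exists k.+1, m, l.
  by rewrite [gen_b ^+ k.+1]expgSr invgM !mulgA.
Qed.

Lemma B12_normal_form g : exists n m k, g = expgz gen_b n * a_dyadic m k.
Proof.
have [k [m [l ->]]] := B12_normal_form_sandwich g.
exists (l%:Z - k%:Z)%R, m, l; rewrite expgzBn /a_dyadic /= !mulgA.
by rewrite mulgK.
Qed.

(** * Left-orderings and their positive cones *)

Section LeftOrderings.
Variable G : groupType.
Implicit Types (f g h : G) (P : set G) (le : rel G).

Definition positive_cone P : Prop :=
  [/\ ~ P 1, forall f g, P f -> P g -> P (f * g) &
      forall g, [\/ g = 1, P g | P g^-1]].

Lemma positive_ordering_of_cone P g : ~ P 1 ->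
  positive (ordering_of_cone P) g <-> P g.
Proof.
move=> P1; rewrite /positive /strict /ordering_of_cone invg1 mul1g.
split=> [/andP[/orP[->//|/asboolP //]]|Pg].
apply/andP; split; first by apply/orP; right; apply/asboolP.
by apply: contra_notN P1 => /eqP->.
Qed.

Lemma left_ordering_of_cone P :
  positive_cone P -> left_ordering (ordering_of_cone P).
Proof.
case=> P1 PM Pt; rewrite /ordering_of_cone; split; last first.
  by move=> h f g; rewrite invgM mulgA mulgVK (inj_eq (mulgI h)).
split; [split; [split|]|].
- by move=> f; rewrite eqxx.
- move=> g f h /orP[/eqP-> //|/asboolP Pfg] /orP[/eqP<-|/asboolP Pgh];
    apply/orP; right; apply/asboolP => //.
  by rewrite -(mulgK g f^-1) -mulgA; apply: PM.
- move=> f g /andP[/orP[/eqP //|/asboolP Pfg] /orP[/eqP //|/asboolP Pgf]].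
  by case: P1; rewrite -(mulgV (f^-1 * g)) invgM invgK; apply: PM.
- move=> f g; have [e|H|H] := Pt (f^-1 * g).
  + by rewrite (mulgI f^-1 _ _ (etrans (mulVg f) (esym e))) eqxx.
  + by apply/orP; left; apply/orP; right; apply/asboolP.
  + apply/orP; right; apply/orP; right; apply/asboolP.
    by rewrite invgM invgK in H.
Qed.

Section Theory.
Variable le : rel G.
Hypothesis leL : left_ordering le.

Let lexx f : le f f. Proof. by have [[[[]]]] := leL. Qed.
Let le_trans g f h : le f g -> le g h -> le f h.
Proof. by have [[[[_ tr] _] _] _] := leL; exact: tr. Qed.
Let le_anti f g : le f g -> le g f -> f = g.
Proof. by have [[[_ A] _] _] := leL => fg gf; apply: A; rewrite fg. Qed.
Let le_total f g : le f g || le g f.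
Proof. by have [[_ +] _] := leL; apply. Qed.

Lemma le_mul2l h f g : le (h * f) (h * g) = le f g.
Proof.
have [_ M] := leL; apply/idP/idP; last exact: M.
by move/(M h^-1); rewrite !mulKg.
Qed.

Lemma strict_mul2l h f g : strict le (h * f) (h * g) = strict le f g.
Proof. by rewrite /strict le_mul2l (inj_eq (mulgI h)). Qed.

Lemma strict_trans g f h : strict le f g -> strict le g h -> strict le f h.
Proof.
move=> /andP[fg nfg] /andP[gh ngh]; apply/andP; split; first exact: le_trans gh.
by apply: contra_neq nfg => fh; apply: le_anti => //; rewrite fh.
Qed.

Lemma le_strict_trans g f h : le f g -> strict le g h -> strict le f h.
Proof.
move=> fg gh; have [<- //|nfg] := eqVneq g f.
by apply: strict_trans gh; rewrite /strict fg eq_sym.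
Qed.

Lemma strict_le_trans g f h : strict le f g -> le g h -> strict le f h.
Proof.
move=> fg gh; have [<- //|nfg] := eqVneq g h.
by apply: strict_trans fg _; rewrite /strict gh.
Qed.

Lemma strictxx f : strict le f f = false.
Proof. by rewrite /strict eqxx andbF. Qed.

Lemma notle_strict f g : ~~ le f g = strict le g f.
Proof.
apply/idP/andP => [nfg|[gf nfg]].
  split; first by have := le_total f g; rewrite (negbTE nfg).
  by apply: contraNneq nfg => ->.
by apply: contra nfg => fg; apply/eqP; apply: le_anti.
Qed.

Lemma strictE f g : strict le f g = positive le (f^-1 * g).
Proof. by rewrite -(strict_mul2l f^-1) mulVg. Qed.

Lemma positiveM f g : positive le f -> positive le g -> positive le (f * g).
Proof. by move=> f0 g0; apply: (strict_trans f0); rewrite strictE mulKg. Qed.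

Lemma positiveX g n : positive le g -> positive le (g ^+ n.+1).
Proof. by move=> g0; elim: n => [|n IH]; rewrite ?expg1 // expgS positiveM. Qed.

Lemma positiveV g : g != 1 -> positive le g^-1 = ~~ positive le g.
Proof.
move=> ng; apply/idP/idP => [gV0|].
  apply/negP => g0; have := positiveM g0 gV0.
  by rewrite mulgV /positive strictxx.
rewrite /positive /strict eq_sym ng andbT notle_strict.
by rewrite strictE mulg1.
Qed.

Lemma positive1 : positive le 1 = false.
Proof. exact: strictxx. Qed.

Lemma positiveXP g n : positive le (g ^+ n.+1) -> positive le g.
Proof.
move=> gn0; apply: contraT => ng.
have [e|/positiveV e] := eqVneq g 1; first by rewrite e expg1n positive1 in gn0.
move: ng; rewrite -e => /(positiveX n); rewrite expVgn => /(positiveM gn0).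
by rewrite mulgV positive1.
Qed.

Lemma oppositeE : opposite le = fun f g => le g f.
Proof.
apply/funext => f; apply/funext => g; rewrite /opposite /ordering_of_cone /=.
rewrite asboolb invgM invgK -strictE /strict eq_sym.
by have [->|_] := eqVneq g f; rewrite ?lexx ?andbT.
Qed.

Lemma strict_opposite f g : strict (opposite le) f g = strict le g f.
Proof. by rewrite oppositeE /strict eq_sym. Qed.

Lemma left_ordering_opposite : left_ordering (opposite le).
Proof.
rewrite oppositeE; split; last by move=> h f g; rewrite le_mul2l.
split; [split; [split|]|].
- by move=> f; apply: lexx.
- by move=> g f h /= gf hg; apply: le_trans gf.
- by move=> f g /andP[gf fg]; apply: le_anti.
- by move=> f g; apply: le_total.
Qed.

End Theory.

Lemma oppositeK le : left_ordering le -> opposite (opposite le) = le.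
Proof.
move=> leL.
by rewrite (oppositeE (left_ordering_opposite leL)) (oppositeE leL).
Qed.

(** An inclusion between positive cones is an equality, since exactly one of g
    and g^-1 is positive as soon as g is not 1. *)
Lemma left_ordering_eq le le' : left_ordering le -> left_ordering le' ->
  (forall g, positive le g -> positive le' g) -> le = le'.
Proof.
move=> leL leL' sub; apply/funext => f; apply/funext => g.
rewrite -[LHS]negbK -[RHS]negbK (notle_strict leL) (notle_strict leL').
congr (~~ _).
rewrite (strictE leL) (strictE leL'); apply/idP/idP; first exact: sub.
apply: contraTT; have [->|ne] := eqVneq (g^-1 * f) 1.
  by rewrite !positive1.
by rewrite -positiveV // => /sub; rewrite positiveV.
Qed.

End LeftOrderings.

(** * Well-orders with prescribed first elements *)

(** Any well-order can be modified by moving p and then q to the front. *)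
Lemma well_order_two_first (T : eqType) (p q : T) : exists wle : rel T,
  [/\ well_order wle, forall z, wle p z & forall z, z != p -> wle q z].
Proof.
have [w0 wo0] := well_ordering_principle T.
pose wle : rel T := fun x y =>
  (x == p) || (y != p) && ((x == q) || (y != q) && w0 x y).
have w0_anti : antisymmetric w0.
  move=> x y; exact: (wo_chain_antisymmetric (C := predT) (withinW wo0)).
exists wle; split=> [|x|x xp]; last 2 first.
- by rewrite /wle eqxx.
- by rewrite /wle xp eqxx orbT.
apply: antisymmetric_well_order.
  move=> x y; rewrite /wle.
  have [->|xp] := eqVneq x p; have [->|yp] //= := eqVneq y p.
  have [->|xq] := eqVneq x q; have [->|yq] //= := eqVneq y q.
  exact: w0_anti.
move=> A A0; have [pA|pA] := boolP (p \in A).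
  by exists p; split=> // x _; rewrite /wle eqxx.
have [qA|qA] := boolP (q \in A).
  exists q; split=> // x xA.
  by rewrite /wle eqxx (contraNneq _ pA) ?orbT // => <-.
have [z [[zA lbz] _]] := wo0 A A0.
exists z; split=> // x xA; rewrite /wle lbz // andbT.
by rewrite (contraNneq _ pA) ?(contraNneq _ qA) ?orbT // => <-.
Qed.

(** * Orientations *)

Section Orientation.
Local Open Scope ring_scope.

Lemma oriented_opp (K : numDomainType) s (x : K) :
  oriented s (- x) = oriented (~~ s) x.
Proof. by case: s; rewrite /oriented ?oppr_gt0 ?oppr_lt0. Qed.

Lemma oriented0 (K : numDomainType) s : @oriented K s 0 = false.
Proof. by case: s; rewrite /oriented ltxx. Qed.

Lemma orientedD (K : realDomainType) s (x y : K) :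
  oriented s x -> oriented s y -> oriented s (x + y).
Proof. by case: s => /= x0 y0; [exact: addr_gt0|lra]. Qed.

Lemma orientedMl (K : numDomainType) s (x y : K) :
  0 < x -> oriented s (x * y) = oriented s y.
Proof. by move=> x0; case: s; rewrite /= ?pmulr_rgt0 ?pmulr_rlt0. Qed.

Lemma oriented_total (K : realDomainType) s (x : K) :
  [\/ x = 0, oriented s x | oriented s (- x)].
Proof.
rewrite oriented_opp; case: s => /=; have [x0|x0|->] := ltgtP x 0;
  by [constructor 1|constructor 2|constructor 3].
Qed.

End Orientation.

(** * The affine representation *)

Lemma rational_ratr (R : realType) (x : R) :
  rational x <-> exists q : rat, x = ratr q.
Proof. by split=> [[q _ <-]|[q ->]]; exists q. Qed.

Section AffineOrderings.
Variable R : realType.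
Local Open Scope ring_scope.
Implicit Types (g h t : B12) (eps x y : R) (m n : int) (k : nat) (s : bool).

Definition offset g : R := xi g 0.
Definition scale g : R := xi g 1 - xi g 0.

Lemma xiV g x : xi g^-1%g (xi g x) = x.
Proof. by rewrite -xiM mulVg xi1. Qed.

Lemma xi_aV x : xi gen_a^-1%g x = x - 1.
Proof. by rewrite -{1}[x](subrK 1) -xi_a xiV. Qed.

Lemma xi_bV x : xi gen_b^-1%g x = x / 2.
Proof.
by rewrite -{1}[x](@divfK _ 2) ?pnatr_eq0 // [_ * 2]mulrC -xi_b xiV.
Qed.

Lemma xi_aX m x : xi (expgz gen_a m) x = x + m%:~R.
Proof.
have pos k y : xi (gen_a ^+ k)%g y = y + k%:R.
  elim: k y => [|k IH] y; first by rewrite addr0 xi1.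
  by rewrite expgSr xiM IH xi_a mulrS addrA.
case: m => k /=; first exact: pos.
by rewrite -{1}[x](subrK k.+1%:R) -pos xiV NegzE mulrNz.
Qed.

Lemma xi_bX n x : xi (expgz gen_b n) x = 2 ^ n * x.
Proof.
have pos k y : xi (gen_b ^+ k)%g y = 2 ^+ k * y.
  elim: k y => [|k IH] y; first by rewrite mul1r xi1.
  by rewrite expgSr xiM IH xi_b exprSr mulrA.
case: n => k /=; first exact: pos.
have n0 : (2 ^+ k.+1 : R) != 0 by rewrite expf_neq0 ?pnatr_eq0.
by rewrite -{1}[x](mulVKf n0) -pos xiV NegzE exprnN.
Qed.

Lemma xi_dyadic m k x : xi (a_dyadic m k) x = x + m%:~R / 2 ^+ k.
Proof.
have n0 : (2 ^+ k : R) != 0 by rewrite expf_neq0 ?pnatr_eq0.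
rewrite /a_dyadic !xiM.
have -> : (gen_b ^- k)%g = expgz gen_b (- k%:Z) :> B12.
  by case: k {n0} => [|k]; rewrite ?invg1.
rewrite xi_aX (xi_bX k) xi_bX -exprnN -exprnP; field.
by rewrite n0.
Qed.

Lemma xi_normal n m k x :
  xi (expgz gen_b n * a_dyadic m k)%g x = 2 ^ n * (x + m%:~R / 2 ^+ k).
Proof. by rewrite xiM xi_bX xi_dyadic. Qed.

Lemma scale_normal n m k : scale (expgz gen_b n * a_dyadic m k)%g = 2 ^ n.
Proof. by rewrite /scale !xi_normal; ring. Qed.

Lemma xiE g x : xi g x = scale g * x + offset g.
Proof.
rewrite /scale /offset; have [n [m [k ->]]] := B12_normal_form g.
by rewrite !xi_normal; ring.
Qed.

Lemma scale_gt0 g : 0 < scale g.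
Proof.
have [n [m [k ->]]] := B12_normal_form g.
by rewrite scale_normal exprz_gt0.
Qed.

Lemma scale1 : scale 1%g = 1.
Proof. by rewrite /scale !xi1 subr0. Qed.

Lemma offset1 : offset 1%g = 0.
Proof. by rewrite /offset xi1. Qed.

Lemma offsetM g h : offset (g * h)%g = scale g * offset h + offset g.
Proof. by rewrite /offset xiM [LHS]xiE. Qed.

Lemma scaleM g h : scale (g * h)%g = scale g * scale h.
Proof. by rewrite {1}/scale !xiM !xiE; ring. Qed.

Lemma scaleX g k : scale (g ^+ k)%g = scale g ^+ k.
Proof.
by elim: k => [|k IH]; rewrite ?scale1 // expgS scaleM IH exprS.
Qed.

Lemma scaleV g : scale g^-1%g = (scale g)^-1.
Proof.
apply: (mulfI (lt0r_neq0 (scale_gt0 g))).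
by rewrite -scaleM mulgV scale1 divff ?lt0r_neq0 ?scale_gt0.
Qed.

Lemma exp2z_eq1 n : 2 ^ n = 1 :> R -> n = 0.
Proof.
move=> e; have l2 : (1 : R) < 2 by rewrite ltr1n.
have := ler_eXz2l l2 n 0; have := ler_eXz2l l2 0 n.
by rewrite expr0z e lexx => le0n len0; apply/eqP; rewrite eq_le -le0n -len0.
Qed.

(** In the normal form b^n a^(m/2^k), the scale 2^n determines n, and then the
    image of 0 determines m/2^k. *)
Lemma xi_faithful g : (forall x, xi g x = x) -> g = 1%g.
Proof.
have [n [m [k ->]]] := B12_normal_form g => id_xi.
have n0 : n = 0.
  by apply: exp2z_eq1; rewrite -(scale_normal n m k) /scale !id_xi subr0.
have := id_xi 0; rewrite xi_normal n0 expr0z mul1r add0r => /eqP.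
rewrite mulf_eq0 invr_eq0 expf_eq0 pnatr_eq0 andbF orbF intr_eq0 => /eqP ->.
by rewrite /a_dyadic /= mulg1 mul1g mulVg.
Qed.

Lemma xi_inj g h : (forall x : R, xi g x = xi h x) -> g = h.
Proof.
move=> gh; apply: (mulgI h^-1%g); rewrite mulVg.
by apply: xi_faithful => x; rewrite xiM gh xiV.
Qed.

Lemma scale_offset_inj g h : scale g = scale h -> offset g = offset h -> g = h.
Proof. by move=> es et; apply: xi_inj => x; rewrite !xiE es et. Qed.

(** * Positive cones of the listed orderings *)

(** Equivalently, xi g x > x for all x close enough to eps, to the right of eps
    if s is true and to the left otherwise. *)
Definition germ_cone eps s : set B12 :=
  [set g | eps < xi g eps \/ xi g eps = eps /\ oriented s (scale g - 1)].

Lemma positive_cone_germ eps s : positive_cone (germ_cone eps s).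
Proof.
split.
- by rewrite /germ_cone /= xi1 scale1 ltxx subrr oriented0 => -[|[]].
- move=> f g.
  have xi_le x y : (xi f x < xi f y) = (x < y).
    by rewrite !xiE ltrD2r ltr_pM2l ?scale_gt0.
  rewrite /germ_cone /= xiM scaleM => -[f0|[f0 sf]] [g0|[g0 sg]].
  + by left; apply: lt_trans f0 _; rewrite xi_le.
  + by left; rewrite g0.
  + by left; rewrite -{1}f0 xi_le.
  + right; rewrite g0 f0; split=> //.
    rewrite (_ : scale f * scale g - 1
             = scale f * (scale g - 1) + (scale f - 1)); last by ring.
    by apply: orientedD => //; rewrite orientedMl ?scale_gt0.
- move=> g; have [lt|gt|fix_eps] := ltgtP eps (xi g eps).
  + by constructor 2; left.
  + constructor 3; left; rewrite -{1}[eps](xiV g) !xiE ltrD2r.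
    by rewrite ltr_pM2l ?scale_gt0 // -xiE.
  + have fixV : xi g^-1%g eps = eps by rewrite {1}fix_eps xiV.
    have [/subr0_eq s1|sg|sg] := oriented_total s (scale g - 1).
    * constructor 1; apply: scale_offset_inj; rewrite ?scale1 // offset1.
      by have := xiE g eps; rewrite -fix_eps s1; lra.
    * by constructor 2; right.
    * constructor 3; right; split=> //; rewrite scaleV.
      rewrite -(orientedMl s _ (scale_gt0 g)) mulrBr mulr1.
      rewrite divff ?lt0r_neq0 ?scale_gt0 //.
      by rewrite -opprB.
Qed.

(** The cone of standard_biordering sa sb, read on scale and offset: the image
    of g in Z has the sign of scale g - 1. *)
Definition standard_cone sa sb : set B12 :=
  [set g | oriented sb (scale g - 1) \/ scale g = 1 /\ oriented sa (offset g)].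

Lemma positive_cone_standard sa sb : positive_cone (standard_cone sa sb).
Proof.
split.
- by rewrite /standard_cone /= scale1 offset1 subrr !oriented0 => -[|[]].
- move=> f g; rewrite /standard_cone /= scaleM offsetM.
  rewrite (_ : scale f * scale g - 1
             = scale f * (scale g - 1) + (scale f - 1)); last by ring.
  move=> [f0|[f1 f0]] [g0|[g1 g0]].
  + by left; apply: orientedD => //; rewrite orientedMl ?scale_gt0.
  + by left; rewrite g1 subrr mulr0 add0r.
  + by left; rewrite f1 subrr mul1r addr0.
  + by right; rewrite f1 g1 !mul1r; split=> //; apply: orientedD.
- move=> g; have s0 := scale_gt0 g; have n0 := lt0r_neq0 s0.
  have [/subr0_eq s1|sg|sg] := oriented_total sb (scale g - 1).
  + have := mulgV g => /(congr1 offset); rewrite offsetM s1 mul1r offset1 => eV.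
    have {}eV : offset g^-1%g = - offset g by lra.
    have [t0|t0|t0] := oriented_total sa (offset g).
    * by constructor 1; apply: scale_offset_inj; rewrite ?scale1 ?offset1.
    * by constructor 2; right.
    * by constructor 3; right; rewrite eV scaleV s1 invr1.
  + by constructor 2; left.
  + constructor 3; left; rewrite scaleV.
    rewrite -(orientedMl sb _ s0) mulrBr mulr1 divff //.
    by rewrite -opprB.
Qed.

Lemma oriented_dyadic (K : numFieldType) s m k :
  oriented s (m%:~R / 2 ^+ k : K) = oriented s m.
Proof.
have p : (0 : K) < (2 ^+ k)^-1 by rewrite invr_gt0 exprn_gt0.
by case: s; rewrite /= ?pmulr_lgt0 ?pmulr_llt0 // ?ltr0z ?ltrz0.
Qed.

Lemma scale_dyadic m k : scale (a_dyadic m k) = 1.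
Proof. by rewrite -[a_dyadic m k]mul1g; exact: (scale_normal 0). Qed.

Lemma offset_dyadic m k : offset (a_dyadic m k) = m%:~R / 2 ^+ k.
Proof. by rewrite /offset xi_dyadic add0r. Qed.

Lemma oriented_exp2 s n : oriented s (2 ^ n - 1 : R) = oriented s n.
Proof.
have l2 : (1 : R) < 2 by rewrite ltr1n.
rewrite -[X in _ - X](expr0z 2).
by case: s; rewrite /= ?subr_gt0 ?subr_lt0 ltr_eXz2l.
Qed.

Lemma standard_biorderingE sa sb :
  standard_biordering sa sb = ordering_of_cone (standard_cone sa sb).
Proof.
congr ordering_of_cone; apply/seteqP; split=> g /=.
- move=> [[m [k [-> H]]]|[n [m [k [-> H]]]]].
    right; rewrite scale_dyadic offset_dyadic oriented_dyadic.
    by rewrite -(oriented_dyadic rat _ _ k).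
  by left; rewrite scale_normal oriented_exp2.
- have [n [m [k ->]]] := B12_normal_form g.
  rewrite /standard_cone /= scale_normal oriented_exp2.
  move=> [H|[e]]; first by right; exists n, m, k.
  rewrite (exp2z_eq1 e) /= mul1g offset_dyadic !oriented_dyadic => H.
  by left; exists m, k; rewrite oriented_dyadic.
Qed.

(** The only possible fixed point of an element of scale different from 1 is
    offset g / (1 - scale g), a rational number. *)
Lemma irrational_not_fixed eps g : irrational eps -> xi g eps = eps -> g = 1%g.
Proof.
move=> irr fix_eps; apply: contrapT => g1; apply: irr.
have [n [m [k eg]]] := B12_normal_form g.
have s1 : scale g <> 1.
  move=> s1; apply: g1; apply: scale_offset_inj; rewrite ?scale1 ?offset1 //.
  by have := xiE g eps; rewrite fix_eps s1; lra.
apply/rational_ratr; exists (2 ^ n * (m%:~R / 2 ^+ k) / (1 - 2 ^ n)).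
rewrite !(rmorphM, fmorphV, rmorphB, fmorphXz, rmorphXn) /= ratr_int rmorph1.
rewrite -/(ratr 2) ratr_nat -(scale_normal n m k) -eg.
have -> : scale g * (m%:~R / 2 ^+ k) = offset g.
  by rewrite eg scale_normal /offset xi_normal add0r.
have := xiE g eps; rewrite fix_eps => e.
have n0 : 1 - scale g != 0 by rewrite subr_eq0; apply/eqP => /esym.
by apply: (mulIf n0); rewrite mulfVK //; lra.
Qed.

Lemma prec_irrational eps s :
  irrational eps -> prec eps = ordering_of_cone (germ_cone eps s).
Proof.
move=> irr; congr ordering_of_cone; apply/seteqP; split=> g /=; first by left.
case=> // -[/(irrational_not_fixed irr) ->].
by rewrite scale1 subrr oriented0.
Qed.

Lemma positive_prec eps g : positive (prec eps) g <-> eps < xi g eps.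
Proof. by apply: positive_ordering_of_cone; rewrite /= xi1 ltxx. Qed.

(** A sequence of the kind quantified over in prec_plus (s true) and in
    prec_minus (s false). *)
Definition irrational_approach s eps (u : nat -> R) : Prop :=
  (forall i, irrational (u i) /\ oriented s (u i - eps)) /\ u @ \oo --> eps.

Lemma germ_cone_eventually eps s u g :
  irrational_approach s eps u -> germ_cone eps s g ->
  \forall n \near \oo, positive (prec (u n)) g.
Proof.
move=> [side lim_u] gg.
suff : \forall n \near \oo, 0 < (scale g - 1) * u n + offset g.
  apply: filterS => n; rewrite positive_prec xiE; lra.
case: gg => [eps_lt|[fix_eps sg]].
  have : (scale g - 1) * u n + offset g @[n --> \oo]
      --> (scale g - 1) * eps + offset g.
    by apply: cvgD; [apply: cvgM => //; apply: cvg_cst|apply: cvg_cst].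
  by move=> /cvgr_gt; apply; move: eps_lt; rewrite xiE; lra.
apply: nearW => n; have [_] := side n.
rewrite (_ : _ + _ = (scale g - 1) * (u n - eps)); last first.
  by move: fix_eps; rewrite xiE; lra.
case: s sg {side} => /= sg us; first exact: mulr_gt0.
by rewrite nmulr_rgt0.
Qed.

(** The numbers eps + pi / n and eps - pi / n will do, pi being irrational.
    Without such sequences the limits defining prec_plus and prec_minus would
    be vacuous. *)
Lemma irrational_approach_exists s eps :
  rational eps -> exists u, irrational_approach s eps u.
Proof.
move=> /rational_ratr[q eq_eps].
exists (fun i : nat => eps + (if s then pi else - pi) / i.+1%:R); split=> [n|].
  split.
    move=> /rational_ratr[p ep].
    apply: (@pi_irrationnal R); apply/rational_ratr.
    exists ((if s then p - q else q - p) * n.+1%:R).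
    have n0 : (n.+1%:R : R) != 0 by rewrite pnatr_eq0.
    by case: s ep => /= ep; rewrite rmorphM rmorphB /= ratr_nat -eq_eps -ep;
       field; rewrite addrC natr1.
  have p0 := divr_gt0 (pi_gt0 R) (ltr0Sn R n).
  by rewrite addrC addKr; case: s => //=; rewrite mulNr oppr_lt0.
rewrite -[X in _ --> X]addr0; apply: cvgD; first exact: cvg_cst.
rewrite -[X in _ --> X](mulr0 (if s then pi else - pi)).
by apply: cvgM; [apply: cvg_cst|exact: cvg_harmonic].
Qed.

(** For the converse direction, an element outside germ_cone eps s is 1 or has
    its inverse in the cone; along a sequence approaching eps it is then
    eventually not positive. *)
Lemma eventually_germ_cone eps s g : rational eps ->
  (forall u, irrational_approach s eps u ->
     \forall n \near \oo, positive (prec (u n)) g) <-> germ_cone eps s g.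
Proof.
move=> rat_eps; split=> [ev|gg u ap]; last exact: germ_cone_eventually ap gg.
have [u ap] := irrational_approach_exists s rat_eps.
have evg := ev u ap.
have [_ _ /(_ g)[g1|//|gV]] := positive_cone_germ eps s.
  have [n] := filter_ex evg.
  by rewrite positive_prec g1 xi1 ltxx.
have [n []] := filter_ex (filterI evg (germ_cone_eventually ap gV)).
have irr := (ap.1 n).1.
have L : left_ordering (prec (u n)).
  rewrite (prec_irrational true irr).
  exact/left_ordering_of_cone/positive_cone_germ.
by move=> g0 gV0; have := positiveM L g0 gV0; rewrite mulgV positive1.
Qed.

Lemma prec_plusE eps :
  rational eps -> prec_plus eps = ordering_of_cone (germ_cone eps true).
Proof.
move=> rat_eps; congr ordering_of_cone; apply/funext => g; apply/propext.
rewrite -(eventually_germ_cone _ _ rat_eps).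
split=> ev u.
  by case=> side; apply: ev => n; have := side n; rewrite /= subr_gt0.
by move=> side lim_u; apply: ev; split=> // n; rewrite /= subr_gt0; exact: side.
Qed.

Lemma prec_minusE eps :
  rational eps -> prec_minus eps = ordering_of_cone (germ_cone eps false).
Proof.
move=> rat_eps; congr ordering_of_cone; apply/funext => g; apply/propext.
rewrite -(eventually_germ_cone _ _ rat_eps).
split=> ev u.
  by case=> side; apply: ev => n; have := side n; rewrite /= subr_lt0.
by move=> side lim_u; apply: ev; split=> // n; rewrite /= subr_lt0; exact: side.
Qed.

(** The rationality of eps only decides which name the ordering has. *)
Lemma prec_familyE (le : rel B12) :
  prec_family R le <-> exists eps s, le = ordering_of_cone (germ_cone eps s).
Proof.
split=> [[] [eps Heps ->]|[eps [s ->]]].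
- by exists eps, true; exact: prec_irrational.
- by exists eps, true; exact: prec_plusE.
- by exists eps, false; exact: prec_minusE.
- have [rat_eps|irr] := pselect (rational eps).
    case: s; [constructor 2|constructor 3]; exists eps;
      by rewrite ?prec_plusE ?prec_minusE.
  by constructor 1; exists eps; rewrite // (prec_irrational s).
Qed.

(** * The subgroup <<a>> *)

Lemma offset_a : offset gen_a = 1.
Proof. by rewrite /offset xi_a add0r. Qed.

Lemma scale_a : scale gen_a = 1.
Proof. by rewrite /scale !xi_a; ring. Qed.

Lemma scale_b : scale gen_b = 2.
Proof. by rewrite /scale !xi_b; ring. Qed.

Lemma gen_a_neq1 : gen_a != 1%g.
Proof.
apply/eqP => a1; have := offset_a; rewrite a1 offset1 => /eqP.
by rewrite eq_sym oner_eq0.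
Qed.

Lemma offsetVM g h : offset (g^-1 * h)%g = (scale g)^-1 * (offset h - offset g).
Proof.
have n0 := lt0r_neq0 (scale_gt0 g); apply: (mulfI n0).
by rewrite mulVKf // -{2}[h](mulVKg g) (offsetM g); ring.
Qed.

Lemma translation_dyadic t : scale t = 1 -> exists m k, t = a_dyadic m k.
Proof.
have [n [m [k ->]]] := B12_normal_form t; rewrite scale_normal.
by move=> /exp2z_eq1 ->; exists m, k; rewrite /= mul1g.
Qed.

Lemma translationX t k : scale t = 1 -> offset (t ^+ k)%g = k%:R * offset t.
Proof.
move=> t1; elim: k => [|k IH]; first by rewrite offset1 mul0r.
by rewrite expgS offsetM t1 IH mul1r -natr1 mulrDl mul1r.
Qed.

Lemma translationVM t u : scale t = 1 -> scale u = 1 ->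
  scale (t^-1 * u)%g = 1 /\ offset (t^-1 * u)%g = offset u - offset t.
Proof. by move=> t1 u1; rewrite scaleM scaleV offsetVM t1 u1 invr1 !mul1r. Qed.

Lemma translationM t u : scale t = 1 -> scale u = 1 ->
  scale (t * u)%g = 1 /\ offset (t * u)%g = offset t + offset u.
Proof. by move=> t1 u1; rewrite scaleM offsetM t1 u1 !mul1r addrC. Qed.

(** u is the conjugate of t by b, that is t^2; only its offset matters. *)
Lemma translation_bJ t : scale t = 1 ->
  exists u,
    [/\ scale u = 1, offset u = 2 * offset t & (gen_b * t = u * gen_b)%g].
Proof.
move=> t1; exists (gen_b * t * gen_b^-1)%g; rewrite mulgVK; split=> //.
  by rewrite !scaleM scaleV t1 mulr1 scale_b divff // pnatr_eq0.
by rewrite /offset !xiM xi_bV mul0r xi_b.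
Qed.

Lemma translation_dense x y :
  x < y -> exists t, scale t = 1 /\ x < offset t < y.
Proof.
(* As 2^N > 1/(y - x), some multiple of 2^-N lies between x and y. *)
move=> xy; pose N := Num.bound (y - x)^-1.
have dy0 : 0 < y - x by lra.
have N0 : (0 : R) < 2 ^+ N by rewrite exprn_gt0.
have N1 : 1 < 2 ^+ N * (y - x).
  rewrite -ltr_pdivrMr // mul1r.
  apply: (lt_trans (archi_boundP _)); first by rewrite invr_ge0 ltW.
  by rewrite -natrX ltr_nat ltn_expl.
exists (a_dyadic (Num.floor (2 ^+ N * x) + 1) N).
split; first exact: scale_dyadic.
rewrite offset_dyadic ltr_pdivlMr // ltr_pdivrMr // mulrC (mulrC y).
have /andP[lo hi] := floor_itv (2 ^+ N * x).
rewrite hi intrD /=; lra.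
Qed.

Section Translations.
Variable le : rel B12.
Hypothesis leL : left_ordering le.

(** If t = a^(m/2^k), then t^(2^k) = a^m, and a power has the sign of its
    root. *)
Lemma positive_translation t : scale t = 1 ->
  oriented (positive le gen_a) (offset t) -> positive le t.
Proof.
move=> t1; have [m [k et]] := translation_dyadic t1.
rewrite et offset_dyadic oriented_dyadic -et => om.
have [j ej] : exists j, (2 ^ k = j.+1)%N.
  by exists (2 ^ k).-1; rewrite prednK // expn_gt0.
apply: (positiveXP leL (n := j)); rewrite -ej.
have -> : (t ^+ (2 ^ k))%g = expgz gen_a m.
  apply: scale_offset_inj.
    rewrite scaleX t1 expr1n; apply: esym.
    by rewrite /scale !xi_aX; ring.
  rewrite translationX // et offset_dyadic natrX /offset xi_aX add0r.
  by rewrite mulrC divfK // expf_neq0 ?pnatr_eq0.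
case: m om {et} => [[|n]|n] /=; first by rewrite oriented0.
  by case a0: (positive le gen_a) => //= _; apply: positiveX.
case a0: (positive le gen_a) => //= _; rewrite -expVgn; apply: positiveX => //.
by rewrite positiveV ?a0 // gen_a_neq1.
Qed.

Lemma positive_Xl g h k :
  positive le g -> positive le h -> positive le (g ^+ k * h)%g.
Proof. by case: k => [|k] g0 h0; rewrite ?mul1g // positiveM // positiveX. Qed.

(** * Orderings in which b lies above or below <<a>> *)

(** The sign of a settles the elements of <<a>>, so only those outside <<a>>
    remain to be compared with the bi-ordering. *)
Lemma standard_of_positive sb :
  (forall g, oriented sb (scale g - 1) -> positive le g) ->
  le = standard_biordering (positive le gen_a) sb.
Proof.
move=> pos; have cone := positive_cone_standard (positive le gen_a) sb.
rewrite standard_biorderingE; apply: esym; apply: left_ordering_eq => //.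
  exact: left_ordering_of_cone.
move=> g; rewrite positive_ordering_of_cone; last by case: cone.
by case=> [/pos //|[]]; exact: positive_translation.
Qed.

(** For n > 0, b^n t is a product of positive elements: b, taken n - 1 times,
    and b t = u b, which is positive because u^-1 < b. *)
Lemma standard_of_b_above : (forall t, scale t = 1 -> strict le t gen_b) ->
  le = standard_biordering (positive le gen_a) true.
Proof.
move=> b_above; apply: standard_of_positive => g.
have [n [m [k ->]]] := B12_normal_form g; rewrite scale_normal oriented_exp2.
case: n => // -[//|n] _; rewrite /= expgSr -mulgA; apply: positive_Xl.
  by apply: b_above; rewrite scale1.
have [u [u1 _ ->]] := translation_bJ (scale_dyadic m k).
rewrite -{1}[u]invgK -strictE //; apply: b_above.
by rewrite scaleV u1 invr1.
Qed.

Lemma standard_of_b_below : (forall t, scale t = 1 -> strict le gen_b t) ->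
  le = standard_biordering (positive le gen_a) false.
Proof.
move=> b_below; apply: standard_of_positive => g.
have [n [m [k ->]]] := B12_normal_form g; rewrite scale_normal oriented_exp2.
case: n => // n _; rewrite /= -expVgn expgSr -mulgA; apply: positive_Xl.
  by rewrite -[_^-1%g]mulg1 -strictE //; apply: b_below; rewrite scale1.
by rewrite -strictE //; apply: b_below; rewrite scale_dyadic.
Qed.

(** * Orderings in which <<a>> is cofinal *)

Section Cut.
Hypothesis a_gt1 : positive le gen_a.
Variables t_lo t_hi : B12.
Hypotheses (t_lo1 : scale t_lo = 1) (t_hi1 : scale t_hi = 1).
Hypotheses (t_lo_b : le t_lo gen_b) (b_t_hi : le gen_b t_hi).

(** An element of <<a>> of offset exactly x, if there is one, may lie on either
    side of g or be equal to it. *)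
Definition cut g x : Prop :=
  (forall t, scale t = 1 -> offset t < x -> strict le t g) /\
  (forall t, scale t = 1 -> x < offset t -> strict le g t).

Lemma translation_lt t u : scale t = 1 -> scale u = 1 ->
  offset t < offset u -> strict le t u.
Proof.
move=> t1 u1 tu; rewrite strictE //; have [tu1 otu] := translationVM t1 u1.
by apply: positive_translation => //; rewrite a_gt1 otu /= subr_gt0.
Qed.

Lemma cut1 : cut 1%g 0.
Proof.
by split=> t t1 ht; apply: translation_lt; rewrite ?scale1 ?offset1.
Qed.

Definition b_value : R :=
  sup [set x | exists t, [/\ scale t = 1, le t gen_b & x = offset t]].

Lemma cut_b_value : cut gen_b b_value.
Proof.
rewrite /b_value; set E := [set x | _].
have E0 : E !=set0 by exists (offset t_lo), t_lo.
have ub_E : has_ubound E.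
  exists (offset t_hi) => _ [t [t1 tb ->]]; rewrite leNgt; apply/negP => lt_t.
  have := translation_lt t_hi1 t1 lt_t => /(le_strict_trans leL b_t_hi).
  by move/(le_strict_trans leL tb); rewrite strictxx.
split=> t t1 ht.
  have [_ [u [u1 ub ->]] tu] := sup_gt E0 ht.
  exact: (strict_le_trans leL (translation_lt t1 u1 tu)).
rewrite -notle_strict //; apply: contraL ht => tb; rewrite -leNgt.
by apply: ub_le_sup => //; exists t.
Qed.

Lemma cut_translation t g x :
  scale t = 1 -> cut g x -> cut (t * g)%g (x + offset t).
Proof.
move=> t1 [lo hi]; split=> u u1 hu; have [e1 e2] := translationVM t1 u1;
  rewrite -(strict_mul2l leL t^-1%g) mulKg; [apply: lo|apply: hi] => //;
  rewrite e2; lra.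
Qed.

(** When r < 2 x + b_value, some r' < x has r - 2 r' < b_value, and then
    a^r < a^(2 r') b = b a^r' < b g; symmetrically on the other side. *)
Lemma cut_b g x : cut g x -> cut (gen_b * g)%g (2 * x + b_value).
Proof.
move=> [lo hi]; have [blo bhi] := cut_b_value; split=> t t1 ht.
  have [|u [u1 /andP[tu ux]]] :=
    @translation_dense ((offset t - b_value) / 2) x; first lra.
  have [v [v1 ov ev]] := translation_bJ u1.
  have bu : strict le (gen_b * u)%g (gen_b * g)%g.
    by rewrite strict_mul2l //; exact: lo.
  apply: strict_trans bu => //; rewrite ev -(strict_mul2l leL v^-1%g) mulKg.
  have [e1 e2] := translationVM v1 t1; apply: blo => //; rewrite e2 ov; lra.
have [|u [u1 /andP[xu ut]]] :=
  @translation_dense x ((offset t - b_value) / 2); first lra.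
have [v [v1 ov ev]] := translation_bJ u1.
have bu : strict le (gen_b * g)%g (gen_b * u)%g.
  by rewrite strict_mul2l //; exact: hi.
apply: (strict_trans leL bu); rewrite ev -(strict_mul2l leL v^-1%g) mulKg.
have [e1 e2] := translationVM v1 t1; apply: bhi => //; rewrite e2 ov; lra.
Qed.

Lemma cut_bV g x : cut g x -> cut (gen_b^-1 * g)%g ((x - b_value) / 2).
Proof.
move=> [lo hi]; have [blo bhi] := cut_b_value; split=> t t1 ht;
  rewrite -(strict_mul2l leL gen_b) mulVKg;
  have [v [v1 ov ->]] := translation_bJ t1.
  have [|u [u1 /andP[bu ux]]] :=
    @translation_dense b_value (x - 2 * offset t); first lra.
  apply: (strict_trans leL (g := (v * u)%g)).
    by rewrite strict_mul2l //; exact: bhi.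
  by have [e1 e2] := translationM v1 u1; apply: lo => //; rewrite e2 ov; lra.
have [|u [u1 /andP[xu ub]]] :=
  @translation_dense (x - 2 * offset t) b_value; first lra.
apply: (strict_trans leL (g := (v * u)%g)); last first.
  by rewrite strict_mul2l //; exact: blo.
by have [e1 e2] := translationM v1 u1; apply: hi => //; rewrite e2 ov; lra.
Qed.

(** Left multiplication acts on cuts as xi acts on the line, up to the
    translation by b_value. *)
Lemma cut_xi g : cut g (xi g b_value - b_value).
Proof.
elim/B12_ind: g => [|g IH|g IH|g IH|g IH].
- by rewrite xi1 subrr; exact: cut1.
- rewrite xiM xi_a addrAC -offset_a; apply: cut_translation => //.
  exact: scale_a.
- rewrite xiM xi_aV addrAC (_ : -1 = offset gen_a^-1%g).
    by apply: cut_translation; rewrite // scaleV scale_a invr1.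
  by rewrite /offset xi_aV sub0r.
- rewrite xiM xi_b.
  rewrite (_ : _ - _ = 2 * (xi g b_value - b_value) + b_value); last by ring.
  exact: cut_b.
- rewrite xiM xi_bV.
  rewrite (_ : _ - _ = (xi g b_value - b_value - b_value) / 2); last by field.
  exact: cut_bV.
Qed.

Lemma positive_of_xi g : b_value < xi g b_value -> positive le g.
Proof.
move=> lt; have [lo _] := cut_xi g; apply: lo; first exact: scale1.
by rewrite offset1 subr_gt0.
Qed.

End Cut.
End Translations.

Lemma xi_fix_X g x k : xi g x = x -> xi (g ^+ k)%g x = x.
Proof.
by move=> fix_x; elim: k => [|k IH]; rewrite ?xi1 // expgS xiM IH.
Qed.

(** An element fixing x is determined by its scale, a power of 2. *)
Lemma stabilizer_commensurable x g h :
  xi g x = x -> xi h x = x -> 1 < scale g -> 1 < scale h ->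
  exists i j, (g ^+ i.+1 = h ^+ j.+1)%g.
Proof.
move=> gx hx; have scale_nat f : 1 < scale f -> exists i, scale f = 2 ^+ i.+1.
  have [n [m [k ->]]] := B12_normal_form f; rewrite scale_normal.
  rewrite -subr_gt0 -[_ < _]/(oriented true _) oriented_exp2.
  by case: n => [[//|n]|//] _; exists n.
move=> /scale_nat[i gi] /scale_nat[j hj]; exists j, i.
have es : scale (g ^+ j.+1)%g = scale (h ^+ i.+1)%g.
  by rewrite !scaleX gi hj -!exprM mulnC.
apply: (scale_offset_inj es).
have := xi_fix_X j.+1 gx; have := xi_fix_X i.+1 hx.
by rewrite !xiE es; lra.
Qed.

(** All expanding elements of the stabilizer of eps have powers in common,
    hence the same sign; s records whether this sign is positive. *)
Lemma germ_of_xi_positive le eps : left_ordering le ->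
  (forall g, eps < xi g eps -> positive le g) ->
  exists s, le = ordering_of_cone (germ_cone eps s).
Proof.
move=> leL pos.
pose s := `[< exists h, [/\ xi h eps = eps, 1 < scale h & positive le h] >].
exists s; apply: esym; have cone := positive_cone_germ eps s.
apply: left_ordering_eq => // [|g]; first exact: left_ordering_of_cone.
rewrite positive_ordering_of_cone; last by case: cone.
case=> [/pos //|[gx]]; rewrite /s; case: asboolP => /= [[h [hx h1 h0]]|none].
  rewrite subr_gt0 => g1.
  have [i [j e]] := stabilizer_commensurable gx hx g1 h1.
  by apply: (positiveXP leL (n := i)); rewrite e; exact: positiveX.
rewrite subr_lt0 => g1; apply: contraT => ng; case: none.
exists g^-1%g; split; first by rewrite -{1}gx xiV.
  by rewrite scaleV invf_gt1 // scale_gt0.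
rewrite positiveV //; apply: contraTneq g1 => ->.
by rewrite scale1 ltxx.
Qed.

(** * The classification *)

Lemma prec_family_of_cut le : left_ordering le -> positive le gen_a ->
  (exists2 t, scale t = 1 & le t gen_b) ->
  (exists2 t, scale t = 1 & le gen_b t) ->
  prec_family R le.
Proof.
move=> leL a0 [t_lo lo1 lob] [t_hi hi1 bhi].
have [|s ->] := @germ_of_xi_positive le (b_value le) leL.
  by move=> g; exact: (positive_of_xi leL a0 lo1 hi1 lob bhi).
by apply/prec_familyE; exists (b_value le), s.
Qed.

Lemma left_ordering_classification le : left_ordering le ->
  [\/ exists sa sb, le = standard_biordering sa sb, prec_family R le |
      exists2 le0, prec_family R le0 & le = opposite le0].
Proof.
move=> leL.
have [above|] := pselect (forall t, scale t = 1 -> strict le t gen_b).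
  constructor 1; exists (positive le gen_a), true.
  exact: standard_of_b_above.
move=> /existsNP[t_hi /not_implyP[hi1 /negP]].
rewrite -notle_strict // negbK => bhi.
have [below|] := pselect (forall t, scale t = 1 -> strict le gen_b t).
  constructor 1; exists (positive le gen_a), false.
  exact: standard_of_b_below.
move=> /existsNP[t_lo /not_implyP[lo1 /negP]].
rewrite -notle_strict // negbK => lob.
have [a0|a0] := boolP (positive le gen_a).
  by constructor 2; apply: prec_family_of_cut => //; [exists t_lo|exists t_hi].
constructor 3; exists (opposite le); last by rewrite oppositeK.
apply: prec_family_of_cut; first exact: left_ordering_opposite.
- rewrite /positive strict_opposite // strictE // mulg1.
  by rewrite positiveV // gen_a_neq1.
- by exists t_hi => //; rewrite oppositeE.
- by exists t_lo => //; rewrite oppositeE.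
Qed.

Lemma left_ordering_prec_family le : prec_family R le -> left_ordering le.
Proof.
move=> /prec_familyE[eps [s ->]].
exact/left_ordering_of_cone/positive_cone_germ.
Qed.

Lemma left_ordering_standard sa sb : left_ordering (standard_biordering sa sb).
Proof.
rewrite standard_biorderingE.
exact/left_ordering_of_cone/positive_cone_standard.
Qed.

(** * Conradian and induced orderings *)

(** A bi-ordering is Conradian already with n = 1: the conjugate of a positive
    f by g is positive. *)
Lemma conradian_standard sa sb : conradian (standard_biordering sa sb).
Proof.
move=> f g f0 g0; exists 1%N => //.
have leL := left_ordering_standard sa sb.
have cone := positive_cone_standard sa sb.
rewrite strictE // expg1; move: f0; rewrite standard_biorderingE.
rewrite !positive_ordering_of_cone; try by case: cone.
rewrite /standard_cone /= offsetVM offsetM !scaleM scaleV.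
rewrite (mulrCA _^-1) mulVf ?mulr1 ?lt0r_neq0 ?scale_gt0 //.
case=> [f0|[f1 f0]]; [by left|right; split=> //].
by rewrite f1 mul1r addrAC subrr add0r orientedMl // invr_gt0 scale_gt0.
Qed.

(** The well-order starts with p and then p + 1 or p - 1.  An element moving p
    is compared at p.  An element g other than 1 fixing p moves every other
    point, hence is compared at the second one, where the displacement is
    (scale g - 1) * (+1 or -1).  Stated for any affine action with the linear
    parts of xi, as it serves for xi and for its conjugate by x |-> - x. *)
Lemma induced_ordering_basepoint (act : B12 -> R -> R) (p : R) s :
  (forall g x y, act g x - act g y = scale g * (x - y)) ->
  exists2 wle, well_order wle & induced_ordering act wle =
    ordering_of_cone
      [set g | p < act g p \/ act g p = p /\ oriented s (scale g - 1)].
Proof.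
move=> lin; pose d : R := if s then 1 else -1.
have [wle [wo first_p first_q]] := well_order_two_first p (p + d).
exists wle => //; congr ordering_of_cone; apply/seteqP; split=> g /=.
  move=> [w minw lt_w]; have gw : act g w != w by rewrite gt_eqF.
  have [z [_ uniq_z]] := wo [pred w' | act g w' != w'] (ex_intro _ w gw).
  have wz := uniq_z w minw.
  have [gp|gp] := eqVneq (act g p) p; last first.
    left; have <- : w = p; last by [].
    by rewrite -wz; apply: uniq_z; split=> // x _; exact: first_p.
  have dE : p + d - p = d by rewrite addrC addKr.
  right; split=> //.
  have gE x : act g x - x = (scale g - 1) * (x - p).
    by have := lin g x p; rewrite gp => e; rewrite mulrBl mul1r -e; ring.
  have ewd : w = p + d.
    rewrite -wz; apply: uniq_z; split=> [|x].
      rewrite inE -subr_eq0 gE mulf_eq0 negb_or dE; apply/andP; split.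
        apply: contraNneq gw => s1; apply/eqP.
        by apply/subr0_eq; rewrite gE s1 mul0r.
      by rewrite /d; case: (s); rewrite ?oppr_eq0 oner_eq0.
    rewrite inE => gx; apply: first_q.
    by apply: contraNneq gx => ->; rewrite gp.
  move: lt_w; rewrite -subr_gt0 gE ewd dE /d.
  by case: (s) => /=; lra.
move=> [lt_p|[gp sg]].
  exists p => //; split=> [|x _]; last exact: first_p.
  by rewrite inE gt_eqF.
have lt_q : p + d < act g (p + d).
  have := lin g (p + d) p; rewrite gp /d; case: (s) sg => /=; lra.
exists (p + d) => //; split=> [|x]; first by rewrite inE gt_eqF.
by rewrite inE => gx; apply: first_q; apply: contraNneq gx => ->; rewrite gp.
Qed.

Lemma affine_xi : affine_action (@xi R) /\ faithful_action (@xi R).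
Proof.
split; last by move=> f; exact: xi_faithful.
split; last first.
  move=> g; exists (scale g), (offset g).
  by split=> [|x]; rewrite ?scale_gt0 // xiE.
split=> [w|f g w|g w w' ww']; [exact: xi1|exact: xiM|].
by rewrite !xiE lerD2r ler_pM2l // scale_gt0.
Qed.

(** Conjugating by a reflection reverses the sign of every displacement while
    keeping the action orientation-preserving; this accounts for opposites. *)
Definition xi_flip g x : R := - xi g (- x).

Lemma affine_xi_flip : affine_action xi_flip /\ faithful_action xi_flip.
Proof.
rewrite /xi_flip; split; last first.
  move=> f fE; apply: xi_faithful => x.
  by have := fE (- x); rewrite opprK => /oppr_inj.
split; last first.
  move=> g; exists (scale g), (- offset g).
  by split=> [|x]; rewrite ?scale_gt0 // xiE; ring.
split=> [w|f g w|g w w' ww']; rewrite ?xi1 ?xiM ?opprK //.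
by rewrite lerN2 !xiE lerD2r ler_pM2l ?scale_gt0 // lerN2.
Qed.

Lemma germ_coneV eps s g : germ_cone eps s g^-1%g <->
  xi g eps < eps \/ xi g eps = eps /\ oriented (~~ s) (scale g - 1).
Proof.
have s0 := scale_gt0 g; rewrite /germ_cone /=.
have xiVE : (xi g^-1%g eps = eps) <-> (xi g eps = eps).
  by split=> e; rewrite -{1}e ?xiV // -xiM mulgV xi1.
have ltV : (eps < xi g^-1%g eps) = (xi g eps < eps).
  by rewrite -(ltr_pM2l s0) -(ltrD2r (offset g)) -!(xiE g) -xiM mulgV xi1.
have osV : oriented s (scale g^-1%g - 1) = oriented (~~ s) (scale g - 1).
  rewrite scaleV -(orientedMl s _ s0) mulrBr mulr1 divff ?lt0r_neq0 //.
  by rewrite -opprB oriented_opp.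
by rewrite xiVE ltV osV.
Qed.

Lemma opposite_germ eps s : opposite (ordering_of_cone (germ_cone eps s)) =
  ordering_of_cone [set g | - eps < xi_flip g (- eps) \/
    xi_flip g (- eps) = - eps /\ oriented (~~ s) (scale g - 1)].
Proof.
have [P1 _ _] := positive_cone_germ eps s.
congr ordering_of_cone; apply/funext => g; apply/propext => /=.
rewrite positive_ordering_of_cone // germ_coneV /xi_flip opprK ltrN2.
split=> -[lt|[e o]]; [left|right|left|right]; rewrite ?e //.
by split=> //; exact: oppr_inj.
Qed.

Lemma nonconradian_induced le : left_ordering le -> ~ conradian le ->
  exists (act : B12 -> R -> R) (wle : rel R),
    [/\ affine_action act, faithful_action act, well_order wle &
        le = induced_ordering act wle].
Proof.
move=> leL nC; have [|fam|[le0 fam ->]] := left_ordering_classification leL.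
- by move=> [sa [sb e]]; case: nC; rewrite e; exact: conradian_standard.
- have /prec_familyE[eps [s ->]] := fam; have [aff faith] := affine_xi.
  have [|wle wo e] := @induced_ordering_basepoint (@xi R) eps s.
    by move=> g x y; rewrite !xiE; ring.
  by exists (@xi R), wle; rewrite e.
- have /prec_familyE[eps [s ->]] := fam; have [aff faith] := affine_xi_flip.
  have [|wle wo e] := @induced_ordering_basepoint xi_flip (- eps) (~~ s).
    by move=> g x y; rewrite /xi_flip !xiE; ring.
  by exists xi_flip, wle; rewrite e opposite_germ.
Qed.

End AffineOrderings.

Theorem theorem4p2 (R : realType) :
  (forall le : rel B12,
     left_ordering le <->
     [\/ exists sa sb : bool, le = standard_biordering sa sb,
         prec_family R le |
         exists2 le0 : rel B12, prec_family R le0 & le = opposite le0]) /\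
  (forall le : rel B12, left_ordering le -> ~ conradian le ->
     exists (act : B12 -> R -> R) (wle : rel R),
       [/\ affine_action act, faithful_action act, well_order wle &
           le = induced_ordering act wle]).
Proof.
split=> [le|]; last exact: nonconradian_induced.
split; first exact: left_ordering_classification.
case=> [[sa [sb ->]]|/left_ordering_prec_family //|[le0 fam ->]].
  exact: (left_ordering_standard R).
by apply: left_ordering_opposite; exact: left_ordering_prec_family fam.
Qed.
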